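(* Let $R$ be a commutative ring. The natural map $Br^*(R) \to Br(R)$ is an isomorphism if and only if endomorphism rings of faithful finitely generated projective $R$-modules are stably matrix algebras. If all faithful finitely generated projective $R$-modules are free, or even stably tensor free, then all their endomorphism rings are stably matrix algebras.
   Context: If $N\subseteq M$ is a submonoid of a commutative monoid, $M/N$ is the monoid of equivalence classes of $M$ under: $m_1\sim m_2$ iff there are $n_1,n_2\in N$ with $m_1n_1=m_2n_2$. $MA(R)$ is the monoid of isomorphism classes of Azumaya $R$-algebras with operation induced by $\otimes_R$; $ME(R)\subseteq MA(R)$ is the submonoid of classes of endomorphism rings of faithful finitely generated projective $R$-modules; $MM(R)\subseteq MA(R)$ is the submonoid of classes of matrix algebras $M_n(R)$, $n\ge1$. $Br^*(R)=MA(R)/MM(R)$ and $Br(R)=MA(R)/ME(R)$ (the Brauer group); the map $Br^*(R)\to Br(R)$ sends the class of $A$ to the class of $A$. An $R$-algebra $A$ is a stably matrix algebra if there are $n,m\ge1$ such that $A\otimes_R M_n(R)\cong M_m(R)$ as $R$-algebras. A faithful finitely generated projective $R$-module $P$ is stably tensor free if there are $n,m\ge 1$ such that $P\otimes_R R^n\cong R^m$. *)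

(* Defs.v *)
From HB Require Import structures.
From mathcomp Require Import all_boot all_algebra.
From mathcomp Require Import generic_quotient boolp.

Set Implicit Arguments.
Unset Strict Implicit.
Unset Printing Implicit Defensive.

Import GRing.Theory.
Local Open Scope ring_scope.
Local Open Scope quotient_scope.

Section Linear.
Variable R : comPzRingType.
Implicit Types U V W : lmodType R.

Definition mklin U V (f : U -> V) (fL : linear f) : {linear U -> V} :=
  HB.pack f (GRing.isLinear.Build R U V *:%R f fL).

Lemma linearE_ext U V (f g : {linear U -> V}) : f =1 g -> f = g.
Proof.
move=> /funext; case: f g => [f [[[f1 f2]] [f3]]] [g [[[g1 g2]] [g3]]] /= e.
by subst g; do !f_equal; apply: Prop_irrelevance.
Qed.

Lemma linear_of U V (f : {linear U -> V}) : linear f.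
Proof. exact: linearP. Qed.

Lemma linear_comp U V W (g : V -> W) (f : U -> V) :
  linear g -> linear f -> linear (fun x => g (f x)).
Proof. by move=> gL fL a x y; rewrite fL gL. Qed.

Lemma linear_inv U V (f : U -> V) (g : V -> U) :
  linear f -> cancel f g -> cancel g f -> linear g.
Proof. by move=> fL fK gK a x y; rewrite -[LHS]fK -{1}[x]gK -{1}[y]gK -fL !fK. Qed.

Lemma linear_sum_fun U V I (s : seq I) (F : I -> U -> V) :
  (forall i, linear (F i)) -> linear (fun x => \sum_(i <- s) F i x).
Proof.
move=> FL a x y; rewrite scaler_sumr -big_split; apply: eq_bigr => i _.
exact: FL.
Qed.

Lemma linear_sumE U V (f : U -> V) (fL : linear f) I (s : seq I) (F : I -> U) :
  f (\sum_(i <- s) F i) = \sum_(i <- s) f (F i).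
Proof. exact: (linear_sum (mklin fL)). Qed.

Lemma linear_ZE U V (f : U -> V) (fL : linear f) a x : f (a *: x) = a *: f x.
Proof. exact: (linearZ_LR (mklin fL)). Qed.

Lemma linear_DE U V (f : U -> V) (fL : linear f) x y : f (x + y) = f x + f y.
Proof. exact: (linearD (mklin fL)). Qed.

End Linear.

Section Modules.
Variable R : comPzRingType.

Definition lmod_iso (M N : lmodType R) : Prop :=
  exists f : {linear M -> N}, bijective f.

Definition faithful (M : lmodType R) : Prop :=
  forall r : R, (forall x : M, r *: x = 0) -> r = 0.

Definition fin_gen (M : lmodType R) : Prop :=
  exists n (e : 'I_n -> M), forall x, exists c : 'I_n -> R,
    x = \sum_(i < n) c i *: e i.

Definition projective (P : lmodType R) : Prop :=
  forall (M N : lmodType R) (g : {linear M -> N}) (f : {linear P -> N}),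
    (forall y, exists x, g x = y) ->
  exists h : {linear P -> M}, forall x, g (h x) = f x.

(* Faithful, finitely generated, projective. *)
Definition ffgp (P : lmodType R) : Prop :=
  [/\ faithful P, fin_gen P & projective P].

(* A basis is a set: a family [e] in B without repetition is independent. *)
Definition is_basis (M : lmodType R) (B : M -> Prop) : Prop :=
  (forall x, exists n (e : 'I_n -> M) (c : 'I_n -> R),
      (forall i, B (e i)) /\ x = \sum_(i < n) c i *: e i) /\
  (forall n (e : 'I_n -> M) (c : 'I_n -> R),
      (forall i, B (e i)) -> injective e ->
      \sum_(i < n) c i *: e i = 0 -> forall i, c i = 0).

Definition free_module (M : lmodType R) : Prop :=
  exists B : M -> Prop, is_basis B.

End Modules.

Section TensorDef.
Variables (R : comPzRingType) (M N : lmodType R).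

Definition is_bilinear (V : lmodType R) (f : M -> N -> V) : Prop :=
  (forall y, linear (f ^~ y)) /\ (forall x, linear (f x)).

Definition formal_sum_eval (V : lmodType R) (f : M -> N -> V)
  (s : seq (M * N)) : V := \sum_(p <- s) f p.1 p.2.

(* A tensor is a formal sum of pairs, two formal sums being identified when no
   bilinear map separates them: this is the congruence generated by the
   bilinearity relations, since the quotient by the latter is the target of a
   bilinear map. *)
Definition tensor_rel (s t : seq (M * N)) : bool :=
  `[< forall (V : lmodType R) (f : M -> N -> V), is_bilinear f ->
        formal_sum_eval f s = formal_sum_eval f t >].

Lemma tensor_rel_refl : reflexive tensor_rel.
Proof. by move=> s; apply/asboolP. Qed.

Lemma tensor_rel_sym : symmetric tensor_rel.
Proof.
by move=> s t; apply/asboolP/asboolP => H V f /H ->.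
Qed.

Lemma tensor_rel_trans : transitive tensor_rel.
Proof.
move=> t s u /asboolP H1 /asboolP H2; apply/asboolP => V f fB.
by rewrite H1 // H2.
Qed.

Canonical tensor_equiv :=
  EquivRel tensor_rel tensor_rel_refl tensor_rel_sym tensor_rel_trans.

Definition tensor : Type := {eq_quot tensor_rel}.
HB.instance Definition _ := Choice.on tensor.
HB.instance Definition _ := EqQuotient.on tensor.

(* The linear map induced by [f] when [f] is bilinear. *)
Definition tlift (V : lmodType R) (f : M -> N -> V) (u : tensor) : V :=
  formal_sum_eval f (repr u).

Lemma tlift_pi (V : lmodType R) (f : M -> N -> V) s : is_bilinear f ->
  tlift f (\pi_tensor s) = formal_sum_eval f s.
Proof.
by move=> fB; move: (reprK (\pi_tensor s)) => /eqquotP/asboolP; apply.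
Qed.

Lemma tlift_inj (u v : tensor) :
  (forall (V : lmodType R) (f : M -> N -> V), is_bilinear f ->
     tlift f u = tlift f v) -> u = v.
Proof.
by move=> H; rewrite -[u]reprK -[v]reprK; apply/eqquotP/asboolP.
Qed.

Definition tpure (x : M) (y : N) : tensor := \pi_tensor [:: (x, y)].
Definition tadd (u v : tensor) : tensor := \pi_tensor (repr u ++ repr v).
Definition tzero : tensor := \pi_tensor [::].
Definition tscale (a : R) (u : tensor) : tensor :=
  \pi_tensor [seq (a *: p.1, p.2) | p <- repr u].

Section Lift.
Variables (V : lmodType R) (f : M -> N -> V) (fB : is_bilinear f).

Lemma tlift_pure x y : tlift f (tpure x y) = f x y.
Proof. by rewrite tlift_pi // /formal_sum_eval big_seq1. Qed.

Lemma tlift_add u v : tlift f (tadd u v) = tlift f u + tlift f v.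
Proof. by rewrite tlift_pi // /formal_sum_eval big_cat. Qed.

Lemma tlift_zero : tlift f tzero = 0.
Proof. by rewrite tlift_pi // /formal_sum_eval big_nil. Qed.

Lemma tlift_scale a u : tlift f (tscale a u) = a *: tlift f u.
Proof.
rewrite tlift_pi // /formal_sum_eval big_map scaler_sumr.
apply: eq_bigr => p _ /=; exact: (linear_ZE (fB.1 p.2)).
Qed.

End Lift.

Definition tliftE V f fB :=
  (@tlift_pure V f fB, @tlift_add V f fB, @tlift_zero V f fB,
   @tlift_scale V f fB).

Lemma taddA : associative tadd.
Proof. by move=> u v w; apply: tlift_inj => V f fB; rewrite !tliftE ?addrA. Qed.

Lemma taddC : commutative tadd.
Proof. by move=> u v; apply: tlift_inj => V f fB; rewrite !tliftE // addrC. Qed.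

Lemma tadd0 : left_id tzero tadd.
Proof. by move=> u; apply: tlift_inj => V f fB; rewrite !tliftE // add0r. Qed.

HB.instance Definition _ := GRing.isNmodule.Build tensor taddA taddC tadd0.

Lemma taddN : left_inverse 0 (tscale (-1)) +%R.
Proof.
move=> u; apply: tlift_inj => V f fB.
rewrite [LHS](tlift_add fB) [X in X + _](tlift_scale fB) [RHS](tlift_zero fB).
by rewrite scaleN1r addNr.
Qed.

HB.instance Definition _ := GRing.Nmodule_isZmodule.Build tensor taddN.

Lemma tscaleA a b u : tscale a (tscale b u) = tscale (a * b) u.
Proof. by apply: tlift_inj => V f fB; rewrite !tliftE // scalerA. Qed.

Lemma tscale1 : left_id 1 tscale.
Proof. by move=> u; apply: tlift_inj => V f fB; rewrite !tliftE // scale1r. Qed.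

Lemma tscaleDr : right_distributive tscale +%R.
Proof.
by move=> a u v; apply: tlift_inj => V f fB; rewrite !tliftE // scalerDr.
Qed.

Lemma tscaleDl u : {morph tscale^~ u : a b / a + b}.
Proof.
by move=> a b; apply: tlift_inj => V f fB; rewrite !tliftE // scalerDl.
Qed.

HB.instance Definition _ :=
  GRing.Zmodule_isLmodule.Build R tensor tscaleA tscale1 tscaleDr tscaleDl.

End TensorDef.

Arguments tpure {R M N} x y.
Notation "x ⊗ y" := (tpure x y) (at level 39, left associativity) : ring_scope.

Section TensorTheory.
Variable R : comPzRingType.
Implicit Types M N V W : lmodType R.

Lemma tlift_linear M N V (f : M -> N -> V) : is_bilinear f -> linear (tlift f).
Proof. by move=> fB a u v; rewrite [LHS]tlift_add // [in LHS]tlift_scale. Qed.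

Lemma tpure_bilinear M N : is_bilinear (@tpure R M N).
Proof.
split=> [y a x x'|x a y y']; apply: tlift_inj => V f fB;
  rewrite (tlift_linear fB) !tlift_pure //.
- exact: fB.1.
- exact: fB.2.
Qed.

Lemma tlift_tpure M N (u : tensor M N) : tlift tpure u = u.
Proof.
apply: tlift_inj => V f fB.
rewrite {2}/tlift /formal_sum_eval (linear_sumE (tlift_linear fB)).
by apply: eq_bigr => p _; rewrite tlift_pure.
Qed.

Lemma tensor_sum M N (u : tensor M N) : u = \sum_(p <- repr u) p.1 ⊗ p.2.
Proof. by rewrite -{1}[u]tlift_tpure. Qed.

Lemma tensor_eq_lin M N V (f g : tensor M N -> V) :
  linear f -> linear g -> (forall x y, f (x ⊗ y) = g (x ⊗ y)) -> f =1 g.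
Proof.
move=> fL gL e u; rewrite [u]tensor_sum (linear_sumE fL) (linear_sumE gL).
by apply: eq_bigr => p _.
Qed.

Lemma tpureZl M N a (x : M) (y : N) : (a *: x) ⊗ y = a *: (x ⊗ y).
Proof. exact: (linear_ZE ((tpure_bilinear M N).1 y)). Qed.

Lemma tpureZr M N a (x : M) (y : N) : x ⊗ (a *: y) = a *: (x ⊗ y).
Proof. exact: (linear_ZE ((tpure_bilinear M N).2 x)). Qed.

Lemma tpure_suml M N I (s : seq I) (F : I -> M) (y : N) :
  (\sum_(i <- s) F i) ⊗ y = \sum_(i <- s) F i ⊗ y.
Proof. exact: (linear_sumE ((tpure_bilinear M N).1 y)). Qed.

Lemma tpure_sumr M N I (s : seq I) (F : I -> N) (x : M) :
  x ⊗ (\sum_(i <- s) F i) = \sum_(i <- s) x ⊗ F i.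
Proof. exact: (linear_sumE ((tpure_bilinear M N).2 x)). Qed.

Lemma bilinear_comp M M' N N' V (h : M' -> N' -> V) (f : M -> M') (g : N -> N') :
  is_bilinear h -> linear f -> linear g -> is_bilinear (fun x y => h (f x) (g y)).
Proof.
move=> hB fL gL; split=> [y|x].
  exact: (linear_comp (hB.1 (g y)) fL).
exact: (linear_comp (hB.2 (f x)) gL).
Qed.

Lemma linear_bilinear M N V W (g : V -> W) (f : M -> N -> V) :
  linear g -> is_bilinear f -> is_bilinear (fun x y => g (f x y) : W).
Proof.
by move=> gL fB; split=> [y|x]; apply: linear_comp gL _; [apply: fB.1|apply: fB.2].
Qed.

Definition tmap M M' N N' (f : M -> M') (g : N -> N') :
  tensor M N -> tensor M' N' := tlift (fun x y => f x ⊗ g y).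

Section TMap.
Variables (M M' N N' : lmodType R) (f : M -> M') (g : N -> N').
Hypotheses (fL : linear f) (gL : linear g).

Lemma tmap_bilinear : is_bilinear (fun x y => f x ⊗ g y).
Proof. exact: bilinear_comp (tpure_bilinear _ _) fL gL. Qed.

Lemma tmap_pure x y : tmap f g (x ⊗ y) = f x ⊗ g y.
Proof. by rewrite /tmap tlift_pure //; apply: tmap_bilinear. Qed.

Lemma tmap_linear : linear (tmap f g).
Proof. exact: tlift_linear tmap_bilinear. Qed.

End TMap.

Lemma linear_id M : linear (fun x : M => x).
Proof. by []. Qed.

Lemma tmap_cancel M M' N N' (f : M -> M') (g : N -> N') f' g' :
  linear f -> linear g -> linear f' -> linear g' ->
  cancel f f' -> cancel g g' -> cancel (tmap f g) (tmap f' g').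
Proof.
move=> fL gL fL' gL' fK gK.
apply: (@tensor_eq_lin M N _ (fun u => tmap f' g' (tmap f g u)) id) => //.
  by apply: linear_comp; apply: tmap_linear.
by move=> x y; rewrite !tmap_pure ?fK ?gK.
Qed.

Lemma tmap_bij M M' N N' (f : M -> M') (g : N -> N') :
  linear f -> linear g -> bijective f -> bijective g -> bijective (tmap f g).
Proof.
move=> fL gL [f' fK fK'] [g' gK gK'].
have fL' := linear_inv fL fK fK'; have gL' := linear_inv gL gK gK'.
by exists (tmap f' g'); apply: tmap_cancel.
Qed.

End TensorTheory.

(* Associative unital R-algebras. The library's [algType] excludes the zero
   algebra, but R may be zero and tensor products of nonzero algebras may
   vanish. *)
HB.mixin Record Lmodule_isAssocAlgebra (R : comPzRingType) A
    of GRing.Lmodule R A := {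
  aone : A;
  amul : A -> A -> A;
  amulA : associative amul;
  amul1 : left_id aone amul;
  amulr1 : right_id aone amul;
  amul_linl : forall v : A, linear (amul^~ v);
  amul_linr : forall u : A, linear (amul u)
}.

#[short(type="assocAlgType")]
HB.structure Definition AssocAlgebra (R : comPzRingType) :=
  {A of GRing.Lmodule R A & Lmodule_isAssocAlgebra R A}.

Arguments aone {R s}.
Notation "x ∙ y" := (amul x y) (at level 40, left associativity) : ring_scope.

Section AlgebraMorphisms.
Variable R : comPzRingType.
Implicit Types A B C : assocAlgType R.

Definition is_alg_iso A B (f : A -> B) : Prop :=
  [/\ linear f, f aone = aone, {morph f : x y / x ∙ y} & bijective f].

Definition alg_iso A B : Prop := exists f : A -> B, is_alg_iso f.

Lemma alg_iso_refl A : alg_iso A A.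
Proof. by exists id; split=> //; exists id. Qed.

Lemma alg_iso_sym A B : alg_iso A B -> alg_iso B A.
Proof.
move=> [f [fL f1 fM [g fK gK]]]; exists g; split; last by exists f.
- exact: linear_inv fL fK gK.
- by rewrite -f1 fK.
by move=> x y; rewrite -[LHS]fK -{1}[x]gK -{1}[y]gK -fM !fK.
Qed.

Lemma alg_iso_trans B A C : alg_iso A B -> alg_iso B C -> alg_iso A C.
Proof.
move=> [f [fL f1 fM fb]] [g [gL g1 gM gb]]; exists (g \o f); split.
- exact: linear_comp.
- by rewrite /= f1 g1.
- by move=> x y /=; rewrite fM gM.
- exact: bij_comp.
Qed.

Lemma amul_bilinear A : is_bilinear (fun x y : A => x ∙ y).
Proof. by split; [apply: amul_linl | apply: amul_linr]. Qed.

End AlgebraMorphisms.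

Section TensorAlgebra.
Variables (R : comPzRingType) (A B : assocAlgType R).
Local Notation T := (tensor A B).

Definition tone : T := aone ⊗ aone.
Definition tmul (u v : T) : T :=
  tlift (fun a b => tlift (fun a' b' => (a ∙ a') ⊗ (b ∙ b')) v) u.

Lemma tmul_inner a b :
  is_bilinear (fun (a' : A) (b' : B) => (a ∙ a') ⊗ (b ∙ b')).
Proof.
apply: (@bilinear_comp _ _ _ _ _ _ _ (amul a) (amul b) (tpure_bilinear A B)).
  exact: (amul_bilinear A).2.
exact: (amul_bilinear B).2.
Qed.

Lemma tmul_inner' a' b' :
  is_bilinear (fun (a : A) (b : B) => (a ∙ a') ⊗ (b ∙ b')).
Proof.
apply: (@bilinear_comp _ _ _ _ _ _ _ (amul^~ a') (amul^~ b')
         (tpure_bilinear A B)).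
  exact: (amul_bilinear A).1.
exact: (amul_bilinear B).1.
Qed.

Lemma tmul_outer (v : T) : is_bilinear (fun (a : A) (b : B) =>
  tlift (fun a' b' => (a ∙ a') ⊗ (b ∙ b')) v).
Proof.
rewrite /tlift /formal_sum_eval; split=> [b|a].
  by apply: linear_sum_fun => p; apply: (tmul_inner' p.1 p.2).1.
by apply: linear_sum_fun => p; apply: (tmul_inner' p.1 p.2).2.
Qed.

Lemma tmul_bilinear : is_bilinear tmul.
Proof.
split=> [v|u]; first exact: tlift_linear (tmul_outer v).
rewrite /tmul {1}/tlift /formal_sum_eval; apply: linear_sum_fun => p.
exact: tlift_linear (tmul_inner p.1 p.2).
Qed.

Lemma tmul_pure a b a' b' :
  tmul (a ⊗ b) (a' ⊗ b') = (a ∙ a') ⊗ (b ∙ b').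
Proof.
rewrite /tmul tlift_pure; last exact: tmul_outer.
by rewrite tlift_pure //; apply: tmul_inner.
Qed.

Lemma tmulA : associative tmul.
Proof.
have mL := tmul_bilinear.1; have mR := tmul_bilinear.2.
move=> u v w.
move: u; apply: tensor_eq_lin => [||a1 b1]; first exact: mL.
  by apply: (linear_comp (mL w)); apply: mL.
move: v; apply: tensor_eq_lin => [||a2 b2].
- by apply: (linear_comp (mR _)); apply: mL.
- by apply: (linear_comp (mL w)); apply: mR.
move: w; apply: tensor_eq_lin => [||a3 b3].
- by apply: (linear_comp (mR _)); apply: mR.
- exact: mR.
by rewrite !tmul_pure !amulA.
Qed.

Lemma tmul1 : left_id tone tmul.
Proof.
apply: tensor_eq_lin => [||a b] //; first exact: tmul_bilinear.2.
by rewrite tmul_pure !amul1.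
Qed.

Lemma tmulr1 : right_id tone tmul.
Proof.
apply: tensor_eq_lin => [||a b] //; first exact: tmul_bilinear.1.
by rewrite tmul_pure !amulr1.
Qed.

HB.instance Definition _ := Lmodule_isAssocAlgebra.Build R T
  (aone := tone) (amul := tmul) tmulA tmul1 tmulr1 tmul_bilinear.1 tmul_bilinear.2.

Lemma tensorM (a a' : A) (b b' : B) :
  (a ⊗ b) ∙ (a' ⊗ b') = (a ∙ a') ⊗ (b ∙ b').
Proof. exact: tmul_pure. Qed.

Lemma tensor_morphM (C : assocAlgType R) (f : T -> C) : linear f ->
  (forall a b a' b', f ((a ∙ a') ⊗ (b ∙ b')) = f (a ⊗ b) ∙ f (a' ⊗ b')) ->
  {morph f : u v / u ∙ v}.
Proof.
move=> fL fM u v; have [mL mR] := tmul_bilinear.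
move: u; apply: tensor_eq_lin => [||a b].
- exact: (linear_comp fL (mL v)).
- exact: (linear_comp (amul_linl (f v)) fL).
move: v; apply: tensor_eq_lin => [||a' b'].
- exact: (linear_comp fL (mR _)).
- exact: (linear_comp (amul_linr (f (a ⊗ b))) fL).
by rewrite tensorM fM.
Qed.

End TensorAlgebra.

Section Constructions.
Variable R : comPzRingType.

Lemma reg_linl (v : R^o) : linear (fun u : R^o => u * v).
Proof. by move=> a x y; rewrite mulrDl; congr (_ + _); rewrite -mulrA. Qed.
Lemma reg_linr (u : R^o) : linear (fun v : R^o => u * v).
Proof. by move=> a x y; rewrite mulrDr; congr (_ + _); apply: mulrCA. Qed.
HB.instance Definition _ := Lmodule_isAssocAlgebra.Build R R^o
  (aone := 1 : R^o) (amul := fun a b : R^o => a * b)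
  (@mulrA R) (@mul1r R) (@mulr1 R) reg_linl reg_linr.

Lemma mx_linl n (B : 'M[R]_n) : linear (fun A : 'M[R]_n => A *m B).
Proof. by move=> a x y; rewrite mulmxDl -scalemxAl. Qed.
Lemma mx_linr n (A : 'M[R]_n) : linear (fun B : 'M[R]_n => A *m B).
Proof. by move=> a x y; rewrite mulmxDr -scalemxAr. Qed.
HB.instance Definition _ n := Lmodule_isAssocAlgebra.Build R 'M[R]_n
  (aone := 1%:M) (amul := mulmx)
  (@mulmxA R n n n n) (@mul1mx R n n) (@mulmx1 R n n) (@mx_linl n) (@mx_linr n).

Definition opp_alg (A : Type) : Type := A.
HB.instance Definition _ (M : lmodType R) := GRing.Lmodule.on (opp_alg M).
Definition opp_mul (A : assocAlgType R) (x y : opp_alg A) : opp_alg A :=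
  (y : A) ∙ (x : A).
HB.instance Definition _ (A : assocAlgType R) :=
  Lmodule_isAssocAlgebra.Build R (opp_alg A) (aone := aone) (amul := @opp_mul A)
    (fun x y z => esym (amulA z y x)) amulr1 amul1 amul_linr amul_linl.

Section Endomorphisms.
Variable P : lmodType R.

(* The algebra End_R(P), with composition as multiplication. *)
Definition lend : Type := {linear P -> P}.
HB.instance Definition _ := gen_eqMixin lend.
HB.instance Definition _ := gen_choiceMixin lend.
Implicit Types f g h : lend.

Definition lend_of (f : P -> P) (fL : linear f) : lend := mklin fL.

Lemma lend_zero_lin : linear (fun _ : P => 0 : P).
Proof. by move=> a x y; rewrite scaler0 addr0. Qed.
Lemma lend_add_lin f g : linear (fun x => f x + g x).
Proof. by move=> a x y; rewrite !linearP scalerDr addrACA. Qed.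
Lemma lend_opp_lin f : linear (fun x => - f x).
Proof. by move=> a x y; rewrite linearP opprD scalerN. Qed.
Lemma lend_scale_lin (b : R) f : linear (fun x => b *: f x).
Proof. by move=> a x y; rewrite linearP scalerDr !scalerA mulrC. Qed.
Lemma lend_comp_lin f g : linear (fun x => f (g x)).
Proof. by move=> a x y; rewrite !linearP. Qed.

Definition lend_zero : lend := mklin lend_zero_lin.
Definition lend_add f g : lend := mklin (lend_add_lin f g).
Definition lend_opp f : lend := mklin (lend_opp_lin f).
Definition lend_scale b f : lend := mklin (lend_scale_lin b f).
Definition lend_one : lend := mklin (@linear_id R P).
Definition lend_mul f g : lend := mklin (lend_comp_lin f g).

Lemma lend_addA : associative lend_add.
Proof. by move=> f g h; apply: linearE_ext => x /=; rewrite addrA. Qed.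
Lemma lend_addC : commutative lend_add.
Proof. by move=> f g; apply: linearE_ext => x /=; rewrite addrC. Qed.
Lemma lend_add0 : left_id lend_zero lend_add.
Proof. by move=> f; apply: linearE_ext => x /=; rewrite add0r. Qed.
HB.instance Definition _ := GRing.isNmodule.Build lend lend_addA lend_addC lend_add0.

Lemma lend_addN : left_inverse 0 lend_opp +%R.
Proof. by move=> f; apply: linearE_ext => x /=; rewrite addNr. Qed.
HB.instance Definition _ := GRing.Nmodule_isZmodule.Build lend lend_addN.

Lemma lend_mulA : associative lend_mul.
Proof. by move=> f g h; apply: linearE_ext. Qed.
Lemma lend_mul1 : left_id lend_one lend_mul.
Proof. by move=> f; apply: linearE_ext. Qed.
Lemma lend_mulr1 : right_id lend_one lend_mul.
Proof. by move=> f; apply: linearE_ext. Qed.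
Lemma lend_scaleA a b f : lend_scale a (lend_scale b f) = lend_scale (a * b) f.
Proof. by apply: linearE_ext => x /=; rewrite scalerA. Qed.
Lemma lend_scale1 : left_id 1 lend_scale.
Proof. by move=> f; apply: linearE_ext => x /=; rewrite scale1r. Qed.
Lemma lend_scaleDr : right_distributive lend_scale +%R.
Proof. by move=> a f g; apply: linearE_ext => x /=; rewrite scalerDr. Qed.
Lemma lend_scaleDl f : {morph lend_scale^~ f : a b / a + b}.
Proof. by move=> a b; apply: linearE_ext => x /=; rewrite scalerDl. Qed.
HB.instance Definition _ := GRing.Zmodule_isLmodule.Build R lend
  lend_scaleA lend_scale1 lend_scaleDr lend_scaleDl.

Lemma lend_linl f : linear (lend_mul^~ f).
Proof. by move=> a g h; apply: linearE_ext. Qed.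
Lemma lend_linr f : linear (lend_mul f).
Proof. by move=> a g h; apply: linearE_ext => x; apply: linearP. Qed.
HB.instance Definition _ := Lmodule_isAssocAlgebra.Build R lend
  (aone := lend_one) (amul := lend_mul) lend_mulA lend_mul1 lend_mulr1 lend_linl lend_linr.

End Endomorphisms.
End Constructions.

Section DualBases.
Variable R : comPzRingType.
Implicit Types P Q M N V : lmodType R.

Definition dual_basis P n (e : 'I_n -> P) (c : 'I_n -> P -> R^o) : Prop :=
  (forall i, linear (c i)) /\ (forall x, x = \sum_(i < n) c i x *: e i).

Lemma dual_basisP P : fin_gen P -> projective P ->
  exists n (e : 'I_n -> P) (c : 'I_n -> P -> R^o), dual_basis e c.
Proof.
move=> [n [e eP]] pP.
have gL : linear (fun v : 'rV[R]_n => \sum_(i < n) v 0 i *: e i : P).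
  apply: linear_sum_fun => i a x y.
  by rewrite !mxE scalerDl scalerA.
have gS : forall y : P, exists x, mklin gL x = y.
  move=> y; have [c ->] := eP y; exists (\row_i c i).
  by apply: eq_bigr => i _; rewrite mxE.
have [h hP] := pP _ _ (mklin gL) (mklin (@linear_id R P)) gS.
exists n, e, (fun i x => h x 0 i); split=> [i a x y|x].
  by rewrite linearP !mxE.
by rewrite -[LHS]hP.
Qed.

Lemma dual_basis_fin_gen P n (e : 'I_n -> P) c : dual_basis e c -> fin_gen P.
Proof. by move=> [_ eP]; exists n, e => x; exists (c^~ x). Qed.

Lemma dual_basis_projective P n (e : 'I_n -> P) c :
  dual_basis e c -> projective P.
Proof.
move=> [cL eP] M N g f gS.
have [m mP] := choice (fun i => gS (f (e i))).
have hL : linear (fun x => \sum_(i < n) c i x *: m i).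
  by apply: linear_sum_fun => i a x y; rewrite cL scalerDl scalerA.
exists (mklin hL) => x /=; rewrite linear_sum [in RHS](eP x) linear_sum.
by apply: eq_bigr => i _; rewrite !linearZ mP.
Qed.

Lemma scale_bilinear M : is_bilinear (fun (a : R^o) (x : M) => a *: x).
Proof.
split=> [x a b b'|b a x y]; first by rewrite scalerDl scalerA.
by rewrite scalerDr !scalerA mulrC.
Qed.

Section TensorDual.
Variables (P Q : lmodType R) (n m : nat).
Variables (e : 'I_n -> P) (c : 'I_n -> P -> R^o) (eP : dual_basis e c).
Variables (d : 'I_m -> Q) (b : 'I_m -> Q -> R^o) (dP : dual_basis d b).

Definition coef2 (f : P -> R^o) (g : Q -> R^o) : tensor P Q -> R^o :=
  tlift (fun x y => f x * g y).

Lemma coef2_bilinear (f : P -> R^o) (g : Q -> R^o) : linear f -> linear g ->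
  is_bilinear (fun x y => f x * g y : R^o).
Proof.
move=> fL gL; apply: (bilinear_comp (amul_bilinear R^o) fL gL).
Qed.

Lemma coef2_pure (f : P -> R^o) (g : Q -> R^o) x y : linear f -> linear g ->
  coef2 f g (x ⊗ y) = f x * g y.
Proof. by move=> fL gL; rewrite /coef2 tlift_pure //; apply: coef2_bilinear. Qed.

Lemma tensor_dual2 (u : tensor P Q) :
  u = \sum_i \sum_j (coef2 (c i) (b j) u : R) *: (e i ⊗ d j).
Proof.
have [cL eE] := eP; have [bL dE] := dP.
have L i j : linear (fun u => (coef2 (c i) (b j) u : R) *: (e i ⊗ d j)).
  apply: (linear_comp ((scale_bilinear (tensor P Q)).1 (e i ⊗ d j))).
  exact: tlift_linear (coef2_bilinear (cL i) (bL j)).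
move: u; apply: tensor_eq_lin => //.
  by do 2![apply: linear_sum_fun => ?]; apply: L.
move=> x y; rewrite {1}(eE x) tpure_suml; apply: eq_bigr => i _.
rewrite {1}(dE y) tpure_sumr; apply: eq_bigr => j _.
by rewrite coef2_pure // tpureZl tpureZr scalerA.
Qed.

Lemma tensor_dual_basis : dual_basis
  (fun k : 'I_#|{: 'I_n * 'I_m}| =>
     e (enum_val k).1 ⊗ d (enum_val k).2)
  (fun k => coef2 (c (enum_val k).1) (b (enum_val k).2)).
Proof.
have [cL eE] := eP; have [bL dE] := dP.
split=> [k|u]; first exact: tlift_linear (coef2_bilinear (cL _) (bL _)).
rewrite {1}[u]tensor_dual2 pair_bigA /=.
pose F k := (coef2 (c k.1) (b k.2) u : R) *: (e k.1 ⊗ d k.2).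
by rewrite -(big_enum_val F); apply: eq_bigl.
Qed.

End TensorDual.

Lemma ffgp_dual P : ffgp P ->
  exists n (e : 'I_n -> P) (c : 'I_n -> P -> R^o), dual_basis e c.
Proof. by case=> _; apply: dual_basisP. Qed.

Lemma ffgp_tensor P Q : ffgp P -> ffgp Q -> ffgp (tensor P Q).
Proof.
move=> Pf Qf; have [n [e [c eP]]] := ffgp_dual Pf.
have [m [d [b dP]]] := ffgp_dual Qf.
have D := tensor_dual_basis eP dP.
split; [|exact: dual_basis_fin_gen D|exact: dual_basis_projective D].
move=> r r0; have [fP _ _] := Pf; have [fQ _ _] := Qf; apply: (fQ) => y.
have [bL dE] := dP; rewrite (dE y) scaler_sumr big1 // => j _.
rewrite scalerA (_ : r * _ = 0) ?scale0r //; apply: fP => x.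
have BL : is_bilinear (fun (x : P) (y : Q) => b j y *: x).
  split=> [z|z]; first exact: (scale_bilinear P).2.
  by move=> a u v; rewrite bL scalerDl scalerA.
rewrite -scalerA -(tlift_pure BL) -(linear_ZE (tlift_linear BL)) r0.
exact: (linear0 (mklin (tlift_linear BL))).
Qed.

Lemma ffgp_reg : ffgp (R^o : lmodType R).
Proof.
have D : dual_basis (fun _ : 'I_1 => 1 : R^o) (fun _ x => x).
  by split=> // x; rewrite big_ord1; apply: esym; apply: mulr1.
split; [|exact: dual_basis_fin_gen D|exact: dual_basis_projective D].
by move=> r /(_ 1) <-; apply: esym; apply: mulr1.
Qed.

Lemma ffgp_rV n : (0 < n)%N -> ffgp 'rV[R]_n.
Proof.
move=> n0.
have D : dual_basis (fun i : 'I_n => delta_mx 0 i : 'rV[R]_n)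
                    (fun i (x : 'rV[R]_n) => x 0 i).
  by split=> [i a x y|x]; [rewrite !mxE | apply: row_sum_delta].
split; [|exact: dual_basis_fin_gen D|exact: dual_basis_projective D].
move=> r /(_ (delta_mx 0 (Ordinal n0))) /matrixP /(_ 0 (Ordinal n0)).
by rewrite !mxE !eqxx mulr1.
Qed.

End DualBases.

Section EndTensor.
Variable R : comPzRingType.
Variables P Q : lmodType R.

Definition lend_tmap (f : lend P) (g : lend Q) : lend (tensor P Q) :=
  lend_of (tmap_linear (linear_of f) (linear_of g)).

Lemma lend_tmap_pure f g x y : lend_tmap f g (x ⊗ y) = f x ⊗ g y.
Proof. by apply: tmap_pure; apply: linear_of. Qed.

Lemma lend_tensor_ext (f g : lend (tensor P Q)) :
  (forall x y, f (x ⊗ y) = g (x ⊗ y)) -> f = g.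
Proof.
move=> e; apply: linearE_ext; apply: tensor_eq_lin => //; exact: linear_of.
Qed.

Lemma lend_tmap_bilinear : is_bilinear lend_tmap.
Proof.
split=> [g a f f'|f a g g']; apply: lend_tensor_ext => x y.
  change (lend_tmap (a *: f + f') g (x ⊗ y) =
          a *: lend_tmap f g (x ⊗ y) + lend_tmap f' g (x ⊗ y)).
  by rewrite !lend_tmap_pure; apply: (tpure_bilinear P Q).1.
change (lend_tmap f (a *: g + g') (x ⊗ y) =
        a *: lend_tmap f g (x ⊗ y) + lend_tmap f g' (x ⊗ y)).
by rewrite !lend_tmap_pure; apply: (tpure_bilinear P Q).2.
Qed.

Definition lend_tensor : tensor (lend P) (lend Q) -> lend (tensor P Q) :=
  tlift lend_tmap.

Lemma lend_tensor_linear : linear lend_tensor.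
Proof. exact: tlift_linear lend_tmap_bilinear. Qed.

Lemma lend_tensor_pure f g : lend_tensor (f ⊗ g) = lend_tmap f g.
Proof. exact: tlift_pure lend_tmap_bilinear _ _. Qed.

Lemma rank_one_linear (f : P -> R^o) : linear f ->
  forall p : P, linear (fun x => f x *: p).
Proof. by move=> fL p; apply: (linear_comp ((scale_bilinear P).1 p) fL). Qed.

Lemma lend_ap_linear (M : lmodType R) (x : M) : linear (fun f : lend M => f x).
Proof. by []. Qed.

End EndTensor.

Section EndTensorIso.
Variable R : comPzRingType.
Implicit Types P Q M : lmodType R.

Definition rank_one M (f : M -> R^o) (fL : linear f) (p : M) : lend M :=
  lend_of (rank_one_linear fL p).

Lemma rank_oneE M (f : M -> R^o) (fL : linear f) p x :
  rank_one fL p x = f x *: p.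
Proof. by []. Qed.

Lemma rank_one_lin M (f : M -> R^o) (fL : linear f) : linear (rank_one fL).
Proof.
move=> a p q; apply: linearE_ext => x.
rewrite rank_oneE [RHS](_ : _ = a *: (f x *: p) + f x *: q) //.
by rewrite scalerDr !scalerA mulrC.
Qed.

Lemma lend_tensor_bij P Q : ffgp P -> ffgp Q -> bijective (@lend_tensor R P Q).
Proof.
move=> /ffgp_dual[n [e [c eP]]] /ffgp_dual[m [d [b dP]]].
have [cL eE] := eP; have [bL dE] := dP.
pose r i j : tensor P Q -> tensor (lend P) (lend Q) :=
  tmap (rank_one (cL i)) (rank_one (bL j)).
have rL i j : linear (r i j) by apply: tmap_linear; apply: rank_one_lin.
pose g (phi : lend (tensor P Q)) := \sum_i \sum_j r i j (phi (e i ⊗ d j)).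
have gL : linear g.
  apply: linear_sum_fun => i; apply: linear_sum_fun => j.
  exact: (linear_comp (rL i j) (@lend_ap_linear _ _ (e i ⊗ d j))).
have decomp M k (u : 'I_k -> M) (v : 'I_k -> M -> R^o) (vL : forall i, linear (v i))
  (uE : forall x, x = \sum_i v i x *: u i) (f : lend M) :
  f = \sum_i rank_one (vL i) (f (u i)).
  apply: linearE_ext => x; rewrite {1}(uE x) linear_sum.
  rewrite (linear_sumE (lend_ap_linear x)); apply: eq_bigr => i _.
  by rewrite linearZ.
exists g.
- apply: (@tensor_eq_lin R (lend P) (lend Q) _ (fun u => g (lend_tensor u)) id).
  + exact: (linear_comp gL (@lend_tensor_linear R P Q)).
  + by [].
  move=> f h; rewrite lend_tensor_pure /g.
  rewrite [in RHS](decomp _ _ _ _ cL eE f) [in RHS](decomp _ _ _ _ bL dE h).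
  rewrite tpure_suml; apply: eq_bigr => i _.
  rewrite tpure_sumr; apply: eq_bigr => j _.
  by rewrite lend_tmap_pure /r tmap_pure //; apply: rank_one_lin.
move=> phi; apply: lend_tensor_ext => x y.
rewrite /g (linear_sumE (@lend_tensor_linear R P Q)).
rewrite (linear_sumE (lend_ap_linear (x ⊗ y))).
have key i j t : lend_tensor (r i j t) (x ⊗ y) = (c i x * b j y : R) *: t.
  move: t; apply: tensor_eq_lin.
  - apply: (linear_comp (@lend_ap_linear _ _ (x ⊗ y))).
    exact: (linear_comp (@lend_tensor_linear R P Q) (rL i j)).
  - by move=> a u v; rewrite !scalerDr !scalerA [a * _]mulrC.
  move=> p q; rewrite /r tmap_pure; try exact: rank_one_lin.
  by rewrite lend_tensor_pure lend_tmap_pure !rank_oneE tpureZl tpureZr scalerA.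
rewrite [in RHS](tensor_dual2 eP dP (x ⊗ y)) linear_sum; apply: eq_bigr => i _.
rewrite (linear_sumE (@lend_tensor_linear R P Q)).
rewrite (linear_sumE (lend_ap_linear (x ⊗ y))) linear_sum.
by apply: eq_bigr => j _; rewrite key linearZ coef2_pure.
Qed.

Lemma lend_tensor_iso P Q : ffgp P -> ffgp Q ->
  alg_iso (tensor (lend P) (lend Q)) (lend (tensor P Q)).
Proof.
move=> Pf Qf; exists (@lend_tensor R P Q); split.
- exact: lend_tensor_linear.
- by rewrite lend_tensor_pure; apply: lend_tensor_ext => x y; rewrite lend_tmap_pure.
- apply: tensor_morphM; first exact: lend_tensor_linear.
  move=> f g f' g'; rewrite !lend_tensor_pure; apply: lend_tensor_ext => x y.
  change (lend_tmap (f ∙ f') (g ∙ g') (x ⊗ y) =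
          lend_tmap f g (lend_tmap f' g' (x ⊗ y))).
  by rewrite !lend_tmap_pure.
exact: lend_tensor_bij.
Qed.

End EndTensorIso.

Section TensorIsos.
Variable R : comPzRingType.
Implicit Types M N P Q V : lmodType R.

Lemma bilinear_flip M N V (f : M -> N -> V) :
  is_bilinear f -> is_bilinear (fun y x => f x y).
Proof. by case. Qed.

Lemma tlift_param M N P V (f : P -> M -> N -> V) :
  (forall p, is_bilinear (f p)) -> (forall x y, linear (fun p => f p x y)) ->
  is_bilinear (fun p u => tlift (f p) u).
Proof.
move=> fB fL; split=> [u|p]; last exact: tlift_linear.
by rewrite /tlift /formal_sum_eval; apply: linear_sum_fun => q; apply: fL.
Qed.

Definition tcomm M N : tensor M N -> tensor N M := tlift (fun x y => y ⊗ x).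

Lemma tcomm_bilinear M N : is_bilinear (fun (x : M) (y : N) => y ⊗ x).
Proof. exact/bilinear_flip/tpure_bilinear. Qed.

Lemma tcomm_linear M N : linear (@tcomm M N).
Proof. exact: tlift_linear (@tcomm_bilinear M N). Qed.

Lemma tcomm_pure M N (x : M) (y : N) : tcomm (x ⊗ y) = y ⊗ x.
Proof. exact: tlift_pure (@tcomm_bilinear M N) _ _. Qed.

Lemma tcommK M N : cancel (@tcomm M N) (@tcomm N M).
Proof.
apply: (@tensor_eq_lin R M N _ (fun u => tcomm (tcomm u)) id) => //.
  exact: (linear_comp (@tcomm_linear N M) (@tcomm_linear M N)).
by move=> x y; rewrite !tcomm_pure.
Qed.

Section Assoc.
Variables M N P : lmodType R.

Definition tassoc : tensor (tensor M N) P -> tensor M (tensor N P) :=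
  tlift (fun u z => tlift (fun x y => x ⊗ (y ⊗ z)) u).

Lemma tassoc_inner z : is_bilinear (fun (x : M) (y : N) => x ⊗ (y ⊗ (z : P))).
Proof.
split=> [y|x]; first exact: (tpure_bilinear _ _).1.
exact: (linear_comp ((tpure_bilinear M (tensor N P)).2 x)
                    ((tpure_bilinear N P).1 z)).
Qed.

Lemma tassoc_bilinear : is_bilinear (fun (u : tensor M N) (z : P) =>
  tlift (fun x y => x ⊗ (y ⊗ z)) u).
Proof.
apply: bilinear_flip; apply: tlift_param => [z|x y]; first exact: tassoc_inner.
exact: (linear_comp ((tpure_bilinear M (tensor N P)).2 x)
                    ((tpure_bilinear N P).2 y)).
Qed.

Lemma tassoc_linear : linear tassoc.
Proof. exact: tlift_linear tassoc_bilinear. Qed.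

Lemma tassoc_pure x y z : tassoc ((x ⊗ y) ⊗ z) = x ⊗ (y ⊗ z).
Proof.
by rewrite /tassoc tlift_pure ?(tlift_pure (tassoc_inner z)) //;
  apply: tassoc_bilinear.
Qed.

End Assoc.

Section Assoc'.
Variables M N P : lmodType R.

Definition tassoc' (u : tensor M (tensor N P)) : tensor (tensor M N) P :=
  tcomm (tassoc (tcomm (tassoc (tcomm u)))).

Lemma tassoc'_linear : linear tassoc'.
Proof.
have tC := tcomm_linear; have tA := tassoc_linear.
exact: (linear_comp (tC _ _) (linear_comp (tA _ _ _) (linear_comp (tC _ _)
         (linear_comp (tA _ _ _) (tC _ _))))).
Qed.

Lemma tassoc'_pure x y z : tassoc' (x ⊗ (y ⊗ z)) = (x ⊗ y) ⊗ z.
Proof. by rewrite /tassoc' !(tcomm_pure, tassoc_pure). Qed.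

Lemma tensor_eq_lin3l V (f g : tensor (tensor M N) P -> V) :
  linear f -> linear g ->
  (forall x y z, f ((x ⊗ y) ⊗ z) = g ((x ⊗ y) ⊗ z)) -> f =1 g.
Proof.
move=> fL gL e; apply: tensor_eq_lin => // u z.
move: u; apply: tensor_eq_lin => [||x y //].
  exact: (linear_comp fL ((tpure_bilinear (tensor M N) P).1 z)).
exact: (linear_comp gL ((tpure_bilinear (tensor M N) P).1 z)).
Qed.

Lemma tensor_eq_lin3r V (f g : tensor M (tensor N P) -> V) :
  linear f -> linear g ->
  (forall x y z, f (x ⊗ (y ⊗ z)) = g (x ⊗ (y ⊗ z))) -> f =1 g.
Proof.
move=> fL gL e; apply: tensor_eq_lin => // x u.
move: u; apply: tensor_eq_lin => [||y z //].
  exact: (linear_comp fL ((tpure_bilinear M (tensor N P)).2 x)).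
exact: (linear_comp gL ((tpure_bilinear M (tensor N P)).2 x)).
Qed.

Lemma tassoc_bij : bijective (@tassoc M N P).
Proof.
exists tassoc'.
  apply: (tensor_eq_lin3l (f := fun u => tassoc' (tassoc u)) (g := id)) => //.
    exact: (linear_comp tassoc'_linear (@tassoc_linear M N P)).
  by move=> x y z; rewrite tassoc_pure tassoc'_pure.
apply: (tensor_eq_lin3r (f := fun u => tassoc (tassoc' u)) (g := id)) => //.
  exact: (linear_comp (@tassoc_linear M N P) tassoc'_linear).
by move=> x y z; rewrite tassoc'_pure tassoc_pure.
Qed.

End Assoc'.

Section Unit.
Variable M : lmodType R.

Definition tunit : tensor R^o M -> M := tlift (fun (a : R^o) (x : M) => a *: x).

Lemma tunit_linear : linear tunit.
Proof. exact: tlift_linear (scale_bilinear M). Qed.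

Lemma tunit_pure (a : R^o) (x : M) : tunit (a ⊗ x) = a *: x.
Proof. exact: tlift_pure (scale_bilinear M) _ _. Qed.

Lemma tunit_bij : bijective tunit.
Proof.
exists (fun x => (1 : R^o) ⊗ x); last by move=> x; rewrite tunit_pure scale1r.
apply: (tensor_eq_lin (f := fun u => (1 : R^o) ⊗ tunit u) (g := id)) => //.
  exact: (linear_comp ((tpure_bilinear R^o M).2 1) tunit_linear).
move=> a x; rewrite tunit_pure tpureZr -tpureZl.
by congr (_ ⊗ _); apply: mulr1.
Qed.

End Unit.

Section Swap.
Variables M N P Q : lmodType R.

Definition tswap_in (x : M) (y : N) : tensor P Q ->
  tensor (tensor M P) (tensor N Q) := tlift (fun p q => (x ⊗ p) ⊗ (y ⊗ q)).

Definition tswap :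
  tensor (tensor M N) (tensor P Q) -> tensor (tensor M P) (tensor N Q) :=
  tlift (fun u v => tlift (fun x y => tswap_in x y v) u).

Lemma tswap_in_bilinear x y :
  is_bilinear (fun (p : P) (q : Q) => (x ⊗ p : tensor M P) ⊗ (y ⊗ q : tensor N Q)).
Proof.
apply: (bilinear_comp (tpure_bilinear (tensor M P) (tensor N Q))).
  exact: (tpure_bilinear _ _).2.
exact: (tpure_bilinear _ _).2.
Qed.

Lemma tswap_in_bilinear' (v : tensor P Q) :
  is_bilinear (fun x y => tswap_in x y v).
Proof.
rewrite /tswap_in /tlift /formal_sum_eval.
have H p q : is_bilinear (fun (x : M) (y : N) => (x ⊗ p : tensor M P) ⊗ (y ⊗ q : tensor N Q)).
  apply: (bilinear_comp (f := fun x => x ⊗ p) (g := fun y => y ⊗ q)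
    (tpure_bilinear (tensor M P) (tensor N Q))).
    exact: (tpure_bilinear _ _).1.
  exact: (tpure_bilinear _ _).1.
split=> [y|x]; apply: linear_sum_fun => i; first exact: (H i.1 i.2).1.
exact: (H i.1 i.2).2.
Qed.

Lemma tswap_bilinear : is_bilinear (fun (u : tensor M N) (v : tensor P Q) =>
  tlift (fun x y => tswap_in x y v) u).
Proof.
apply: bilinear_flip; apply: tlift_param => [v|x y].
  exact: tswap_in_bilinear'.
exact: tlift_linear (tswap_in_bilinear x y).
Qed.

Lemma tswap_linear : linear tswap.
Proof. exact: tlift_linear tswap_bilinear. Qed.

Lemma tswap_pure x y p q :
  tswap ((x ⊗ y) ⊗ (p ⊗ q)) = (x ⊗ p) ⊗ (y ⊗ q).
Proof.
rewrite /tswap (tlift_pure tswap_bilinear) (tlift_pure (tswap_in_bilinear' _)).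
exact: tlift_pure (tswap_in_bilinear x y) _ _.
Qed.

Lemma tensor_eq_lin4 V (f g : tensor (tensor M N) (tensor P Q) -> V) :
  linear f -> linear g ->
  (forall x y p q, f ((x ⊗ y) ⊗ (p ⊗ q)) = g ((x ⊗ y) ⊗ (p ⊗ q))) -> f =1 g.
Proof.
move=> fL gL e; apply: tensor_eq_lin3r => // u p q.
move: u; apply: tensor_eq_lin => [||x y //].
  exact: (linear_comp fL ((tpure_bilinear (tensor M N) (tensor P Q)).1 _)).
exact: (linear_comp gL ((tpure_bilinear (tensor M N) (tensor P Q)).1 _)).
Qed.

End Swap.

Lemma tswapK M N P Q : cancel (@tswap M N P Q) (@tswap M P N Q).
Proof.
apply: (tensor_eq_lin4 (f := fun u => tswap (tswap u)) (g := id)) => //.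
  exact: (linear_comp (@tswap_linear M P N Q) (@tswap_linear M N P Q)).
by move=> x y p q; rewrite !tswap_pure.
Qed.

Lemma tswap_bij M N P Q : bijective (@tswap M N P Q).
Proof. by exists (@tswap M P N Q); apply: tswapK. Qed.

End TensorIsos.

Section AlgebraIsos.
Variable R : comPzRingType.
Implicit Types A B C : assocAlgType R.

Lemma tensor_alg_iso A A' B B' :
  alg_iso A A' -> alg_iso B B' -> alg_iso (tensor A B) (tensor A' B').
Proof.
move=> [f [fL f1 fM fb]] [g [gL g1 gM gb]]; exists (tmap f g); split.
- exact: tmap_linear.
- by rewrite tmap_pure // f1 g1.
- apply: tensor_morphM; first exact: tmap_linear.
  by move=> a b a' b'; rewrite !tmap_pure // fM gM tensorM.
exact: tmap_bij.
Qed.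

Lemma tensor_algC A B : alg_iso (tensor A B) (tensor B A).
Proof.
exists (@tcomm R A B); split.
- exact: tcomm_linear.
- exact: tcomm_pure.
- apply: tensor_morphM; first exact: tcomm_linear.
  by move=> a b a' b'; rewrite !tcomm_pure tensorM.
by exists (@tcomm R B A); apply: tcommK.
Qed.

Lemma tensor_algA A B C :
  alg_iso (tensor (tensor A B) C) (tensor A (tensor B C)).
Proof.
exists (@tassoc R A B C); split.
- exact: tassoc_linear.
- exact: tassoc_pure.
- have L := @tassoc_linear R A B C.
  have [mL mR] := amul_bilinear (tensor A (tensor B C)).
  move=> u v; move: u; apply: tensor_eq_lin3l.
  + exact: (linear_comp L (amul_linl v)).
  + exact: (linear_comp (mL (tassoc v)) L).
  move=> a b c; move: v; apply: tensor_eq_lin3l.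
  + exact: (linear_comp L (amul_linr _)).
  + exact: (linear_comp (mR _) L).
  by move=> a' b' c'; rewrite !(tensorM, tassoc_pure).
exact: tassoc_bij.
Qed.

Lemma tensor_alg1 A : alg_iso (tensor (R^o : assocAlgType R) A) A.
Proof.
exists (@tunit R A); split.
- exact: tunit_linear.
- by rewrite tunit_pure scale1r.
- apply: tensor_morphM; first exact: tunit_linear.
  move=> a b a' b'; rewrite !tunit_pure.
  rewrite (linear_ZE (amul_linl _)) (linear_ZE (amul_linr _)).
  by rewrite scalerA.
exact: tunit_bij.
Qed.

Lemma lend_lmod_iso (P Q : lmodType R) : lmod_iso P Q -> alg_iso (lend P) (lend Q).
Proof.
move=> [h [k hK kK]].
have hL := linear_of h; have kL := linear_inv hL hK kK.
pose F (f : lend P) : lend Q := lend_of (linear_comp hL (linear_comp (linear_of f) kL)).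
pose G (f : lend Q) : lend P := lend_of (linear_comp kL (linear_comp (linear_of f) hL)).
exists F; split.
- by move=> a f g; apply: linearE_ext => x; apply: hL.
- by apply: linearE_ext => x; apply: kK.
- by move=> f g; apply: linearE_ext => x /=; rewrite hK.
by exists G => f; apply: linearE_ext => x /=; rewrite ?hK ?kK.
Qed.

Lemma mx_lend_iso n : alg_iso 'M[R]_n (lend 'rV[R]_n).
Proof.
have L (A : 'M[R]_n) : linear (fun v : 'rV[R]_n => v *m A^T).
  by move=> a u v; rewrite mulmxDl -scalemxAl.
pose F (A : 'M[R]_n) : lend 'rV[R]_n := lend_of (L A).
exists F; split.
- move=> a A B; apply: linearE_ext => v.
  change (v *m (a *: A + B)^T = a *: (v *m A^T) + v *m B^T).
  by rewrite linearP /= mulmxDr scalemxAr.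
- by apply: linearE_ext => v; rewrite /= trmx1 mulmx1.
- by move=> A B; apply: linearE_ext => v; rewrite /= trmx_mul mulmxA.
exists (fun f : lend 'rV[R]_n => (lin1_mx f)^T) => [A|f].
  by apply/trmx_inj/row_matrixP => i; rewrite trmxK !rowE mul_rV_lin1.
by apply: linearE_ext => v; rewrite /= trmxK mul_rV_lin1.
Qed.

Lemma tensor_rV_iso n m : lmod_iso (tensor 'rV[R]_n 'rV[R]_m) 'rV[R]_(n * m).
Proof.
have B : is_bilinear (fun (u : 'rV[R]_n) (v : 'rV[R]_m) => mxvec (u^T *m v)).
  split=> [v|u] a x y.
    by rewrite linearP mulmxDl -scalemxAl linearP.
  by rewrite mulmxDr -scalemxAr linearP.
pose g (w : 'rV[R]_(n * m)) : tensor 'rV[R]_n 'rV[R]_m :=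
  \sum_i \sum_j vec_mx w i j *: (delta_mx 0 i ⊗ delta_mx 0 j).
have gL : linear g.
  apply: linear_sum_fun => i; apply: linear_sum_fun => j a x y.
  by rewrite linearP !mxE scalerDl scalerA.
have fL := tlift_linear B.
exists (mklin fL); exists g => /=.
  apply: (tensor_eq_lin (linear_comp gL fL)) => // u v.
  rewrite (tlift_pure B) /g mxvecK.
  rewrite [in RHS](row_sum_delta u) tpure_suml; apply: eq_bigr => i _.
  rewrite [in RHS](row_sum_delta v) tpure_sumr; apply: eq_bigr => j _.
  by rewrite mxE big_ord1 mxE tpureZl tpureZr scalerA.
move=> w; rewrite /g (linear_sumE fL) -[RHS]vec_mxK [in RHS](matrix_sum_delta (vec_mx w)).
rewrite linear_sum; apply: eq_bigr => i _.
rewrite (linear_sumE fL) linear_sum; apply: eq_bigr => j _.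
rewrite (linear_ZE fL) (tlift_pure B) linearZ; congr (_ *: mxvec _).
by rewrite trmx_delta mul_delta_mx.
Qed.

Lemma tensor_mx_iso n m : (0 < n)%N -> (0 < m)%N ->
  alg_iso (tensor 'M[R]_n 'M[R]_m) 'M[R]_(n * m).
Proof.
move=> n0 m0; apply: (alg_iso_trans (tensor_alg_iso (mx_lend_iso n) (mx_lend_iso m))).
apply: (alg_iso_trans (lend_tensor_iso (ffgp_rV R n0) (ffgp_rV R m0))).
apply: (alg_iso_trans (lend_lmod_iso (tensor_rV_iso n m))).
exact/alg_iso_sym/mx_lend_iso.
Qed.

Definition reg_lend (a : R^o) : lend R^o := lend_of (@reg_linr R a).

Lemma reg_lend_alg_iso : is_alg_iso reg_lend.
Proof.
split.
- move=> a x y; apply: linearE_ext => z /=.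
  exact: (reg_linl z a x y).
- by apply: linearE_ext => z; apply: mul1r.
- by move=> x y; apply: linearE_ext => z; apply: esym; apply: mulrA.
exists (fun f : lend R^o => f 1) => [a|f]; first exact: mulr1.
apply: linearE_ext => z /=.
rewrite -[in RHS](mulr1 z) [RHS](linear_ZE (linear_of f) z 1); exact: mulrC.
Qed.

Lemma reg_lend_iso : alg_iso R^o (lend R^o).
Proof. by exists reg_lend; apply: reg_lend_alg_iso. Qed.

Lemma reg_mx_iso : alg_iso R^o 'M[R]_1.
Proof.
exists (fun a : R^o => a%:M : 'M[R]_1); split.
- by move=> a x y; rewrite raddfD /= scale_scalar_mx.
- by [].
- by move=> x y; rewrite scalar_mxM.
exists (fun A : 'M[R]_1 => A 0 0) => [a|A]; first by rewrite mxE eqxx.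
by rewrite -mx11_scalar.
Qed.

End AlgebraIsos.

Section Azumaya.
Variable R : comPzRingType.
Implicit Types A B : assocAlgType R.

Lemma sandwich_lin A (a b : A) : linear (fun x => a ∙ x ∙ b).
Proof. exact: (linear_comp (amul_linl b) (amul_linr a)). Qed.

(* a ⊗ b acts on A as x ↦ a x b. *)
Definition sandwich A : tensor A (opp_alg A) -> lend A :=
  tlift (fun (a : A) (b : opp_alg A) => lend_of (sandwich_lin a b)).

Definition azumaya A : Prop := ffgp A /\ is_alg_iso (@sandwich A).

Lemma sandwich_bilinear A :
  is_bilinear (fun (a : A) (b : opp_alg A) => lend_of (sandwich_lin a b)).
Proof.
split=> [b a x y|a b x y]; apply: linearE_ext => z.
  change ((a *: x + y) ∙ z ∙ (b : A) = a *: (x ∙ z ∙ (b : A)) + y ∙ z ∙ (b : A)).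
  exact: (linear_comp (amul_linl (b : A)) (amul_linl z)).
exact: (amul_linr (a ∙ z)).
Qed.

Lemma sandwich_linear A : linear (@sandwich A).
Proof. exact: tlift_linear (@sandwich_bilinear A). Qed.

Lemma sandwich_pure A (a : A) (b : opp_alg A) x :
  sandwich (a ⊗ b) x = a ∙ x ∙ b.
Proof. by rewrite /sandwich (tlift_pure (@sandwich_bilinear A)). Qed.

Lemma sandwich_iso A : bijective (@sandwich A) -> is_alg_iso (@sandwich A).
Proof.
move=> b; split=> //; first exact: sandwich_linear.
  by apply: linearE_ext => x; rewrite sandwich_pure amul1 amulr1.
apply: tensor_morphM; first exact: sandwich_linear.
move=> a1 b1 a2 b2; apply: linearE_ext => x; rewrite sandwich_pure.
change ((a1 ∙ a2) ∙ x ∙ ((b2 : A) ∙ b1) =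
        sandwich (a1 ⊗ b1) (sandwich (a2 ⊗ b2) x)).
by rewrite !sandwich_pure !amulA.
Qed.

Lemma azumaya_tensor A B : azumaya A -> azumaya B -> azumaya (tensor A B).
Proof.
move=> [Af [sAL _ _ sAb]] [Bf [sBL _ _ sBb]]; split; first exact: ffgp_tensor.
apply: sandwich_iso.
pose F (u : tensor (tensor A B) (opp_alg (tensor A B))) :=
  lend_tensor (tmap (@sandwich A) (@sandwich B)
    (@tswap R A B (opp_alg A) (opp_alg B) u)).
have Fb : bijective F.
  apply: (bij_comp (lend_tensor_bij Af Bf)).
  apply: (bij_comp (tmap_bij sAL sBL sAb sBb)).
  exact: (@tswap_bij R A B (opp_alg A) (opp_alg B)).
apply: (eq_bij Fb).
have FL : linear F.
  apply: (linear_comp (@lend_tensor_linear R A B)).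
  apply: (linear_comp (tmap_linear sAL sBL)).
  exact: (@tswap_linear R A B (opp_alg A) (opp_alg B)).
apply: (@tensor_eq_lin4 R A B (opp_alg A) (opp_alg B)) => //.
  exact: sandwich_linear.
move=> a b a' b'; rewrite /F tswap_pure (tmap_pure sAL sBL) lend_tensor_pure.
apply: lend_tensor_ext => x y; rewrite lend_tmap_pure !sandwich_pure.
rewrite tensorM; apply: esym; exact: (tensorM (a ∙ x) a' (b ∙ y) b').
Qed.

Lemma azumaya_reg : azumaya R^o.
Proof.
split; first exact: ffgp_reg.
apply: sandwich_iso.
have [fL _ _ fb] := reg_lend_alg_iso R.
apply: (eq_bij (bij_comp fb (tunit_bij (R^o : lmodType R)))).
apply: tensor_eq_lin.
- exact: (linear_comp fL (@tunit_linear R R^o)).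
- exact: sandwich_linear.
move=> a b; apply: linearE_ext => x.
rewrite sandwich_pure /= tunit_pure; exact: mulrAC.
Qed.

End Azumaya.

(* Quotients are realized as types of equivalence classes, rather than with
   [{eq_quot _}], so that they apply to the type of all algebras over R, which
   is too large to be an [eqType]. *)
Section Classes.
Variables (T : Type) (e : T -> T -> Prop).

Record equivalence_rel_on : Prop := EquivalenceRelOn {
  eqv_refl : forall x, e x x;
  eqv_sym : forall x y, e x y -> e y x;
  eqv_trans : forall y x z, e x y -> e y z -> e x z }.

Record classes := Classes {
  class_mem :> T -> Prop;
  classP : exists x, class_mem = e x }.

Definition class_of (x : T) : classes := Classes (ex_intro _ x erefl).

Hypothesis eE : equivalence_rel_on.

Lemma classes_ext (p q : classes) : (forall x, p x <-> q x) -> p = q.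
Proof.
case: p q => [p pP] [q qP] /= pq.
have E : p = q by apply/funext => x; apply/propext/pq.
by subst q; congr Classes; apply: Prop_irrelevance.
Qed.

Lemma class_of_eq x y : e x y -> class_of x = class_of y.
Proof.
move=> xy; apply: classes_ext => z; split=> /= [xz|]; last exact: eqv_trans xy.
by apply: eqv_trans xz => //; apply: eqv_sym.
Qed.

Lemma class_of_inj x y : class_of x = class_of y -> e x y.
Proof.
by move=> E; move: (eqv_refl eE y); rewrite -[e y y]/(class_of y y) -E.
Qed.

Lemma class_of_surj (p : classes) : exists x, p = class_of x.
Proof.
by case: p => p [x E]; exists x; apply: classes_ext => z /=; rewrite E.
Qed.

End Classes.

Arguments class_of {T e} x.

Section LiftMap.
Variables (T T' : Type) (e : T -> T -> Prop) (e' : T' -> T' -> Prop).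
Hypotheses (eE : equivalence_rel_on e) (eE' : equivalence_rel_on e').
Variable f : T -> T'.
Hypothesis fP : forall x y, e x y -> e' (f x) (f y).

Lemma class_map_subproof (p : classes e) :
  exists y, (fun z => exists2 x, p x & e' (f x) z) = e' y.
Proof.
have [x ->] := class_of_surj p; exists (f x); apply/funext => z; apply/propext.
split=> [[y /= xy yz]|xz]; last by exists x => //; apply: eqv_refl.
exact: eqv_trans (fP xy) yz.
Qed.

Definition class_map (p : classes e) : classes e' :=
  Classes (class_map_subproof p).

Lemma class_mapE x : class_map (class_of x) = class_of (f x).
Proof.
apply: classes_ext => z; split=> [[y /= xy yz]|/= xz].
  exact: eqv_trans (fP xy) yz.
by exists x => //; apply: eqv_refl.
Qed.

End LiftMap.

Section LiftOp.
Variables (T : Type) (e : T -> T -> Prop) (eE : equivalence_rel_on e).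
Variable f : T -> T -> T.
Hypothesis fP : forall x x' y y', e x x' -> e y y' -> e (f x y) (f x' y').

Lemma class_op_subproof (p q : classes e) :
  exists t, (fun z => exists x y, [/\ p x, q y & e (f x y) z]) = e t.
Proof.
have [x ->] := class_of_surj p; have [y ->] := class_of_surj q.
exists (f x y); apply/funext => z; apply/propext; split=> [[x' [y' [xx yy]]]|xz].
  by apply: eqv_trans => //; apply: fP.
by exists x, y; split=> //; apply: eqv_refl.
Qed.

Definition class_op (p q : classes e) : classes e :=
  Classes (class_op_subproof p q).

Lemma class_opE x y : class_op (class_of x) (class_of y) = class_of (f x y).
Proof.
apply: classes_ext => z; split=> [[x' [y' [xx yy]]]|xz].
  by apply: eqv_trans => //; apply: fP.
by exists x, y; split=> //; apply: eqv_refl.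
Qed.

End LiftOp.

Record comMonoid := ComMonoid {
  cm_sort :> Type;
  cm_one : cm_sort;
  cm_mul : cm_sort -> cm_sort -> cm_sort;
  cm_mulA : associative cm_mul;
  cm_mulC : commutative cm_mul;
  cm_mul1 : left_id cm_one cm_mul }.

Arguments cm_one {c}.
Notation "x ⋅ y" := (cm_mul x y) (at level 40, left associativity) : ring_scope.

Record submonoid (M : comMonoid) := Submonoid {
  sm_mem :> M -> Prop;
  sm_one : sm_mem cm_one;
  sm_mul : forall x y, sm_mem x -> sm_mem y -> sm_mem (x ⋅ y) }.

Definition monoid_iso (L L' : comMonoid) (f : L -> L') : Prop :=
  [/\ f cm_one = cm_one, {morph f : x y / x ⋅ y} & bijective f].

Section MonoidQuotient.
Variables (M : comMonoid) (N : submonoid M).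

Definition mquot_rel (m1 m2 : M) : Prop :=
  exists n1 n2, [/\ N n1, N n2 & m1 ⋅ n1 = m2 ⋅ n2].

Lemma cm_mulACA (x y z t : M) : (x ⋅ y) ⋅ (z ⋅ t) = (x ⋅ z) ⋅ (y ⋅ t).
Proof. by rewrite -!cm_mulA [y ⋅ _]cm_mulA [y ⋅ z]cm_mulC !cm_mulA. Qed.

Lemma mquot_equiv : equivalence_rel_on mquot_rel.
Proof.
split=> [m|m m' [n1 [n2 [? ? E]]]|m2 m1 m3 [n1 [n2 [N1 N2 E]]] [p2 [p3 [P2 P3 E']]]].
- by exists cm_one, cm_one; split=> //; apply: sm_one.
- by exists n2, n1.
exists (n1 ⋅ p2), (p3 ⋅ n2); split; try exact: sm_mul.
by rewrite cm_mulA E -cm_mulA [n2 ⋅ _]cm_mulC !cm_mulA E'.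
Qed.

Lemma mquot_mulP x x' y y' :
  mquot_rel x x' -> mquot_rel y y' -> mquot_rel (x ⋅ y) (x' ⋅ y').
Proof.
move=> [n1 [n2 [N1 N2 E]]] [p1 [p2 [P1 P2 E']]].
exists (n1 ⋅ p1), (n2 ⋅ p2); split; try exact: sm_mul.
by rewrite cm_mulACA E E' cm_mulACA.
Qed.

Definition mquot_mul := class_op mquot_equiv mquot_mulP.

Lemma mquot_mulE x y : mquot_mul (class_of x) (class_of y) = class_of (x ⋅ y).
Proof. exact: class_opE. Qed.

Lemma mquot_mulA : associative mquot_mul.
Proof.
move=> p q r; have [x ->] := class_of_surj p; have [y ->] := class_of_surj q.
have [z ->] := class_of_surj r.
by rewrite (mquot_mulE y z) (mquot_mulE x y) !mquot_mulE cm_mulA.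
Qed.

Lemma mquot_mulC : commutative mquot_mul.
Proof.
move=> p q; have [x ->] := class_of_surj p; have [y ->] := class_of_surj q.
by rewrite (mquot_mulE x y) (mquot_mulE y x) cm_mulC.
Qed.

Lemma mquot_mul1 : left_id (class_of cm_one) mquot_mul.
Proof.
by move=> p; have [x ->] := class_of_surj p; rewrite mquot_mulE cm_mul1.
Qed.

Definition mquot : comMonoid := ComMonoid mquot_mulA mquot_mulC mquot_mul1.

End MonoidQuotient.

Section MonoidQuotientMap.
Variables (M : comMonoid) (N N' : submonoid M).
Hypothesis sN : forall x, N x -> N' x.

Lemma mquot_mapP x y : mquot_rel N x y -> mquot_rel N' x y.
Proof. by move=> [n1 [n2 [N1 N2 E]]]; exists n1, n2; split=> //; apply: sN. Qed.

Definition mquot_map : mquot N -> mquot N' :=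
  class_map (mquot_equiv N) (mquot_equiv N') mquot_mapP.

Lemma mquot_mapE x : mquot_map (class_of x) = class_of x.
Proof. exact: class_mapE. Qed.

End MonoidQuotientMap.

Section BrauerMonoids.
Variable R : comPzRingType.

Record azAlg := AzAlg { az_alg :> assocAlgType R; az_azumaya : azumaya az_alg }.

Definition az_iso (A B : azAlg) : Prop := alg_iso A B.

Lemma az_iso_equiv : equivalence_rel_on az_iso.
Proof.
split=> [A|A B|B A C]; [exact: alg_iso_refl | exact: alg_iso_sym |].
exact: alg_iso_trans.
Qed.

Definition az_tensor (A B : azAlg) : azAlg :=
  AzAlg (azumaya_tensor (az_azumaya A) (az_azumaya B)).
Definition az_reg : azAlg := AzAlg (azumaya_reg R).

Lemma az_tensorP A A' B B' :
  az_iso A A' -> az_iso B B' -> az_iso (az_tensor A B) (az_tensor A' B').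
Proof. exact: tensor_alg_iso. Qed.

Definition MA_mul := class_op az_iso_equiv az_tensorP.

Lemma MA_mulE A B : MA_mul (class_of A) (class_of B) = class_of (az_tensor A B).
Proof. exact: class_opE. Qed.

Lemma MA_mulA : associative MA_mul.
Proof.
move=> p q r; have [A ->] := class_of_surj p; have [B ->] := class_of_surj q.
have [C ->] := class_of_surj r.
rewrite (MA_mulE B C) (MA_mulE A B) !MA_mulE.
by apply/(class_of_eq az_iso_equiv)/alg_iso_sym/tensor_algA.
Qed.

Lemma MA_mulC : commutative MA_mul.
Proof.
move=> p q; have [A ->] := class_of_surj p; have [B ->] := class_of_surj q.
rewrite (MA_mulE A B) (MA_mulE B A).
exact/(class_of_eq az_iso_equiv)/tensor_algC.
Qed.

Lemma MA_mul1 : left_id (class_of az_reg) MA_mul.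
Proof.
move=> p; have [A ->] := class_of_surj p; rewrite MA_mulE.
exact/(class_of_eq az_iso_equiv)/tensor_alg1.
Qed.

Definition MA : comMonoid := ComMonoid MA_mulA MA_mulC MA_mul1.

(* [lend P] is itself Azumaya for such P, so [A] ranges over all the algebras
   isomorphic to it. *)
Definition ME_mem (x : MA) : Prop :=
  exists (P : lmodType R) (A : azAlg),
    [/\ ffgp P, alg_iso A (lend P) & x = class_of A].

Definition MM_mem (x : MA) : Prop :=
  exists (n : nat) (A : azAlg),
    [/\ (0 < n)%N, alg_iso A 'M[R]_n & x = class_of A].

Lemma ME_one : ME_mem cm_one.
Proof.
by exists R^o, az_reg; split=> //; [apply: ffgp_reg | apply: reg_lend_iso].
Qed.

Lemma ME_mul x y : ME_mem x -> ME_mem y -> ME_mem (x ⋅ y).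
Proof.
move=> [P [A [Pf iA ->]]] [Q [B [Qf iB ->]]].
exists (tensor P Q), (az_tensor A B); split.
- exact: ffgp_tensor.
- exact: alg_iso_trans (tensor_alg_iso iA iB) (lend_tensor_iso Pf Qf).
- exact: MA_mulE.
Qed.

Definition ME : submonoid MA := Submonoid ME_one ME_mul.

Lemma MM_one : MM_mem cm_one.
Proof. by exists 1%N, az_reg; split=> //; apply: reg_mx_iso. Qed.

Lemma MM_mul x y : MM_mem x -> MM_mem y -> MM_mem (x ⋅ y).
Proof.
move=> [n [A [n0 iA ->]]] [m [B [m0 iB ->]]].
exists (n * m)%N, (az_tensor A B); split.
- by rewrite muln_gt0 n0.
- exact: alg_iso_trans (tensor_alg_iso iA iB) (tensor_mx_iso R n0 m0).
- exact: MA_mulE.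
Qed.

Definition MM : submonoid MA := Submonoid MM_one MM_mul.

Lemma MM_sub_ME x : MM x -> ME x.
Proof.
move=> [n [A [n0 iA ->]]]; exists 'rV[R]_n, A; split=> //; first exact: ffgp_rV.
exact: alg_iso_trans iA (mx_lend_iso R n).
Qed.

Definition Brstar : comMonoid := mquot MM.
Definition Br : comMonoid := mquot ME.

Definition Brstar_to_Br : Brstar -> Br := mquot_map MM_sub_ME.

Lemma Brstar_to_BrE (x : MA) : Brstar_to_Br (class_of x) = class_of x.
Proof. exact: mquot_mapE. Qed.

Definition stably_matrix (A : assocAlgType R) : Prop :=
  exists n m : nat,
    [/\ (0 < n)%N, (0 < m)%N & alg_iso (tensor A 'M[R]_n) 'M[R]_m].

Definition stably_tensor_free (P : lmodType R) : Prop :=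
  exists n m : nat,
    [/\ (0 < n)%N, (0 < m)%N & lmod_iso (tensor P 'rV[R]_n) 'rV[R]_m].

End BrauerMonoids.

(* Main.v *)
(**
  For a finitely generated projective [P] with dual basis [(e_i, c_i)], the
  algebra [End P] is Azumaya: writing [|p><f|] for [x |-> f x *: p], the inverse
  of the sandwich map sends [Phi] to the sum over [i, j, l] of
  [|Phi (|e_j><c_i|) e_l><c_j| ⊗ |e_i><c_l|].  Hence every such [P] defines a
  class of Br*, killed by Br* -> Br; injectivity then says
  [End P ⊗ M_n ≅ M_m] for some [n, m].  Conversely, if [A ⊗ E ≅ B ⊗ E'] with
  [E], [E'] stably matrix algebras, tensoring with matrix algebras turns [E] and
  [E'] into matrix algebras, so [A] and [B] already agree in Br*.
*)
Require Import Defs.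
From mathcomp Require Import all_boot all_algebra.
From mathcomp Require Import boolp.

Set Implicit Arguments.
Unset Strict Implicit.
Unset Printing Implicit Defensive.

Import GRing.Theory.
Local Open Scope ring_scope.

Section EndAzumaya.
Variables (R : comPzRingType) (P : lmodType R).
Variables (n : nat) (e : 'I_n -> P) (c : 'I_n -> P -> R^o).
Hypotheses (cL : forall i, linear (c i)).
Hypothesis eE : forall x, x = \sum_(i < n) c i x *: e i.

Lemma lend_decomp (f : lend P) : f = \sum_i rank_one (cL i) (f (e i)).
Proof.
apply: linearE_ext => x; rewrite {1}(eE x) linear_sum.
rewrite (linear_sumE (lend_ap_linear x)); apply: eq_bigr => i _.
by rewrite linearZ.
Qed.

Lemma lend_decomp2 (f : lend P) :
  f = \sum_i \sum_j (c j (f (e i)) : R) *: rank_one (cL i) (e j).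
Proof.
rewrite {1}(lend_decomp f); apply: eq_bigr => i _.
rewrite {1}(eE (f (e i))) (linear_sumE (rank_one_lin (cL i))).
by apply: eq_bigr => j _; rewrite (linear_ZE (rank_one_lin (cL i))).
Qed.

Lemma lend_dual_basis : dual_basis
  (fun k : 'I_#|{: 'I_n * 'I_n}| =>
     rank_one (cL (enum_val k).1) (e (enum_val k).2))
  (fun k (f : lend P) => c (enum_val k).2 (f (e (enum_val k).1))).
Proof.
split=> [k a f g|f]; first exact: (cL (enum_val k).2).
rewrite {1}[f]lend_decomp2 pair_bigA /=.
pose F k := (c k.2 (f (e k.1)) : R) *: rank_one (cL k.1) (e k.2).
by rewrite -(big_enum_val F); apply: eq_bigl.
Qed.

Definition sandwich_inv (Phi : lend (lend P)) :
    tensor (lend P) (opp_alg (lend P)) :=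
  \sum_i \sum_j \sum_l
    (rank_one (cL j) (Phi (rank_one (cL i) (e j)) (e l)) : lend P) ⊗
      (rank_one (cL l) (e i) : opp_alg (lend P)).

Lemma sandwich_inv_linear : linear sandwich_inv.
Proof.
apply: linear_sum_fun => i; apply: linear_sum_fun => j.
apply: linear_sum_fun => l.
apply: (linear_comp ((tpure_bilinear _ _).1 _)).
exact: (linear_comp (rank_one_lin (cL j))).
Qed.

Lemma sandwich_invK : cancel (@sandwich R (lend P)) sandwich_inv.
Proof.
apply: (tensor_eq_lin (f := fun u => sandwich_inv (sandwich u)) (g := id)) => //.
  exact: (linear_comp sandwich_inv_linear (@sandwich_linear R _)).
move=> a b; rewrite /sandwich_inv.
have E i j l : sandwich (a ⊗ b) (rank_one (cL i) (e j)) (e l) =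
               c i ((b : lend P) (e l)) *: a (e j).
  by rewrite sandwich_pure -linearZ.
under eq_bigr => i _ do under eq_bigr => j _ do under eq_bigr => l _ do
  rewrite E (linear_ZE (rank_one_lin (cL j))) tpureZl -tpureZr.
under eq_bigr => i _ do under eq_bigr => j _ do rewrite -tpure_sumr.
rewrite exchange_big /=.
under eq_bigr => j _ do rewrite -tpure_sumr.
rewrite -tpure_suml -lend_decomp; congr (_ ⊗ _).
rewrite exchange_big /=; exact/esym/(lend_decomp2 (b : lend P)).
Qed.

Lemma sandwichK : cancel sandwich_inv (@sandwich R (lend P)).
Proof.
move=> Phi; apply: linearE_ext => f; apply: linearE_ext => x.
have SL := @sandwich_linear R (lend P).
have AL := linear_comp (lend_ap_linear x) (lend_ap_linear f).
have L := linear_comp AL SL.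
rewrite /sandwich_inv (linear_sumE L) {2}[f]lend_decomp2.
rewrite (linear_sumE (linear_comp (lend_ap_linear x) (linear_of Phi))).
apply: eq_bigr => i _.
rewrite (linear_sumE L).
rewrite (linear_sumE (linear_comp (lend_ap_linear x) (linear_of Phi))).
apply: eq_bigr => j _.
rewrite (linear_sumE L).
rewrite (linear_ZE (linear_comp (lend_ap_linear x) (linear_of Phi))).
rewrite {2}(eE x) linear_sum scaler_sumr; apply: eq_bigr => l _.
rewrite linearZ sandwich_pure.
change (c j (f (c l x *: e i)) *: Phi (rank_one (cL i) (e j)) (e l) =
  c j (f (e i)) *: (c l x *: Phi (rank_one (cL i) (e j)) (e l))).
rewrite linearZ (linear_ZE (cL j)) scalerA; congr (_ *: _); exact: mulrC.
Qed.

End EndAzumaya.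

Section Corollary.
Variable R : comPzRingType.
Implicit Types P Q : lmodType R.

Lemma azumaya_lend P : ffgp P -> azumaya (lend P).
Proof.
move=> Pf; have [n [e [c [cL eE]]]] := ffgp_dual Pf; have [fP _ _] := Pf.
have D := lend_dual_basis cL eE; split.
  split; [|exact: dual_basis_fin_gen D|exact: dual_basis_projective D].
  move=> r r0; apply: fP => x.
  by have := congr1 (fun f : lend P => f x) (r0 (lend_one P)).
apply: sandwich_iso; exists (sandwich_inv e cL).
  exact: sandwich_invK.
exact: sandwichK.
Qed.

Definition az_lend P (Pf : ffgp P) : azAlg R := AzAlg (azumaya_lend Pf).

Lemma ME_lend P (Pf : ffgp P) : ME R (class_of (az_lend Pf)).
Proof. by exists P, (az_lend Pf); split=> //; apply: alg_iso_refl. Qed.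

Lemma MM_lend_rV n (n0 : (0 < n)%N) :
  MM R (class_of (az_lend (ffgp_rV R n0))).
Proof.
exists n, (az_lend (ffgp_rV R n0)); split=> //.
exact/alg_iso_sym/mx_lend_iso.
Qed.

Lemma stably_matrix_MM (A : azAlg R) : stably_matrix A <->
  exists n1 n2 : MA R, [/\ MM R n1, MM R n2 & (class_of A : MA R) ⋅ n1 = n2].
Proof.
split=> [[n [m [n0 m0 i]]]|[_ [_ [[n [B [n0 iB ->]]] [m [C [m0 iC ->]]] E]]]].
  exists (class_of (az_lend (ffgp_rV R n0))), (class_of (az_lend (ffgp_rV R m0))).
  split; try exact: MM_lend_rV.
  rewrite [LHS]MA_mulE; apply: (class_of_eq (az_iso_equiv R)).
  apply: (alg_iso_trans _ (mx_lend_iso R m)).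
  apply: (alg_iso_trans _ i); apply: tensor_alg_iso; first exact: alg_iso_refl.
  exact/alg_iso_sym/mx_lend_iso.
exists n, m; split=> //.
move: E; rewrite [LHS]MA_mulE => /(class_of_inj (az_iso_equiv R)) E.
apply: (alg_iso_trans _ iC); apply: (alg_iso_trans _ E).
by apply: tensor_alg_iso; [exact: alg_iso_refl | exact/alg_iso_sym].
Qed.

Lemma stably_matrix_alg_iso (A B : assocAlgType R) :
  alg_iso A B -> stably_matrix B -> stably_matrix A.
Proof.
move=> i [n [m [n0 m0 j]]]; exists n, m; split=> //.
by apply: alg_iso_trans (tensor_alg_iso i _) j; apply: alg_iso_refl.
Qed.

Lemma inj_surj_bij (T U : Type) (f : T -> U) :
  injective f -> (forall y, exists x, f x = y) -> bijective f.
Proof.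
move=> fI /choice[g gK]; exists g => // x; apply: fI; exact: gK.
Qed.

Lemma Brstar_to_Br_iso_stably_matrix :
  monoid_iso (@Brstar_to_Br R) -> forall P, ffgp P -> stably_matrix (lend P).
Proof.
move=> [f1 _ /bij_inj fI] P Pf.
apply/(stably_matrix_MM (az_lend Pf)).
have /fI : Brstar_to_Br (class_of (class_of (az_lend Pf))) =
           Brstar_to_Br (cm_one : Brstar R).
  rewrite f1 Brstar_to_BrE; apply: (class_of_eq (mquot_equiv (ME R))).
  exists cm_one, (class_of (az_lend Pf)); split.
  - exact: sm_one.
  - exact: ME_lend.
  by rewrite cm_mulC.
move=> /(class_of_inj (mquot_equiv (MM R)))[n1 [n2 [N1 N2 E]]].
by exists n1, n2; split=> //; rewrite E cm_mul1.
Qed.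

Lemma stably_matrix_Brstar_to_Br_iso :
  (forall P, ffgp P -> stably_matrix (lend P)) -> monoid_iso (@Brstar_to_Br R).
Proof.
move=> H.
have ME_MM (x : MA R) : ME R x ->
    exists n1 n2, [/\ MM R n1, MM R n2 & x ⋅ n1 = n2].
  move=> [P [A [Pf iA ->]]]; apply/stably_matrix_MM.
  exact: stably_matrix_alg_iso iA (H P Pf).
split.
- exact: Brstar_to_BrE.
- move=> p q; have [x ->] := class_of_surj p; have [y ->] := class_of_surj q.
  rewrite [X in Brstar_to_Br X](mquot_mulE (MM R) x y) !Brstar_to_BrE.
  exact/esym/mquot_mulE.
apply: inj_surj_bij => [p q|p]; last first.
  by have [x ->] := class_of_surj p; exists (class_of x); apply: Brstar_to_BrE.
have [x ->] := class_of_surj p; have [y ->] := class_of_surj q.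
rewrite !Brstar_to_BrE => /(class_of_inj (mquot_equiv (ME R))).
move=> [m1 [m2 [/ME_MM[a [a' [aM aM' Ea]]] /ME_MM[b [b' [bM bM' Eb]]] E]]].
apply: (class_of_eq (mquot_equiv (MM R))).
exists (a' ⋅ b), (b' ⋅ a); split; try exact: sm_mul.
rewrite -Ea -Eb -[m1 ⋅ a ⋅ b]cm_mulA -[m2 ⋅ b ⋅ a]cm_mulA.
by rewrite !cm_mulA E -!cm_mulA [a ⋅ b]cm_mulC.
Qed.

Lemma lmod_iso_trans (Q P V : lmodType R) :
  lmod_iso P Q -> lmod_iso Q V -> lmod_iso P V.
Proof.
move=> [f fb] [g gb].
exists (mklin (linear_comp (linear_of g) (linear_of f))); exact: bij_comp.
Qed.

Lemma span_lin P (s : seq P) n (c : 'I_n -> R) (F : 'I_n -> P) :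
  (forall i, exists k : P -> R, F i = \sum_(v <- s) k v *: v) ->
  exists k : P -> R, \sum_i c i *: F i = \sum_(v <- s) k v *: v.
Proof.
move=> /choice[k kE]; exists (fun v => \sum_i c i * k i v).
under eq_bigr => i _ do rewrite kE scaler_sumr.
rewrite exchange_big; apply: eq_bigr => v _ /=; rewrite scaler_suml.
by apply: eq_bigr => i _; rewrite scalerA.
Qed.

Lemma span_mem P (s : seq P) v : uniq s -> v \in s ->
  exists k : P -> R, v = \sum_(w <- s) k w *: w.
Proof.
move=> us vs; exists (fun w => (w == v)%:R).
rewrite (bigD1_seq v) //= eqxx scale1r big1 ?addr0 // => w /negPf ->.
by rewrite scale0r.
Qed.

Lemma free_fin_gen_rV P : free_module P -> fin_gen P ->
  exists n, lmod_iso P 'rV[R]_n.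
Proof.
move=> [B [Bs Bi]] [n [e eP]].
have /choice[h hP] : forall i, exists t : seq P, (forall v, v \in t -> B v) /\
    forall s, uniq s -> {subset t <= s} ->
    exists k : P -> R, e i = \sum_(v <- s) k v *: v.
  move=> i; have [m [b [c [bB ->]]]] := Bs (e i).
  exists [seq b j | j <- enum 'I_m]; split=> [_ /mapP[j _ ->] //|s us ts].
  apply: span_lin => j; apply: span_mem => //; apply: ts.
  by rewrite map_f ?mem_enum.
pose s := undup (flatten [seq h i | i <- enum 'I_n]).
have us : uniq (in_tuple s) := undup_uniq _.
have sB v : v \in s -> B v.
  by rewrite mem_undup => /flatten_mapP[i _]; apply: (hP i).1.
have sS x : exists k : P -> R, x = \sum_(v <- s) k v *: v.
  have [c ->] := eP x; apply: span_lin => i; apply: (hP i).2 => // v vh.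
  by rewrite mem_undup; apply/flatten_mapP; exists i; rewrite ?mem_enum.
pose t := tnth (in_tuple s).
have fL : linear (fun u : 'rV[R]_(size s) => \sum_i u 0 i *: t i).
  by apply: linear_sum_fun => i a x y; rewrite !mxE scalerDl scalerA.
pose f := mklin fL.
have fb : bijective f.
  apply: inj_surj_bij => [u w /eqP|x].
    rewrite -subr_eq0 -linearB => /eqP E; apply/rowP => i; apply/eqP.
    rewrite -subr_eq0; apply/eqP.
    have := Bi _ t (fun i => (u - w) 0 i) (fun i => sB _ (mem_tnth i (in_tuple s))).
    by move=> /(_ (elimT (tuple_uniqP (in_tuple s)) us) E i); rewrite !mxE.
  have [k ->] := sS x; exists (\row_i k (t i)).
  rewrite [RHS]big_tnth; by apply: eq_bigr => i _; rewrite mxE.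
have [g fK gK] := fb; exists (size s), (mklin (linear_inv fL fK gK)).
by exists f.
Qed.

Lemma free_stably_tensor_free P :
  ffgp P -> free_module P -> stably_tensor_free P.
Proof.
move=> [fP gP _] /free_fin_gen_rV /(_ gP)[m [f fb]].
suff [m' [m0 [g gb]]] : exists m', (0 < m')%N /\ lmod_iso P 'rV[R]_m'.
  exists 1%N, (m' * 1)%N; split; rewrite ?muln1 //.
  rewrite -{1}[m']muln1.
  apply: lmod_iso_trans (tensor_rV_iso R m' 1).
  exists (mklin (tmap_linear (linear_of g) (@linear_id R 'rV[R]_1))).
  by apply: tmap_bij => //; [exact: linear_of | exists id].
case: m f fb => [|m] f fb; last by exists m.+1; split=> //; exists f.
(* [P = 0] and faithful, so [R = 0] and all modules are isomorphic. *)
have R0 : (1 : R) = 0.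
  by apply: fP => x; apply: (bij_inj fb); rewrite !thinmx0.
have M0 (M : lmodType R) (x y : M) : x = y.
  by rewrite -[x]scale1r -[y]scale1r R0 !scale0r.
exists 1%N; split=> //.
have L : linear (fun _ : P => 0 : 'rV[R]_1).
  by move=> a x y; apply: (M0 'rV[R]_1).
exists (mklin L), (fun _ => 0) => x; first exact: (M0 P).
exact: (M0 'rV[R]_1).
Qed.

Lemma stably_tensor_free_matrix P :
  ffgp P -> stably_tensor_free P -> stably_matrix (lend P).
Proof.
move=> Pf [n [m [n0 m0 i]]]; exists n, m; split=> //.
apply: (alg_iso_trans (tensor_alg_iso (alg_iso_refl _) (mx_lend_iso R n))).
apply: (alg_iso_trans (lend_tensor_iso Pf (ffgp_rV R n0))).
exact: alg_iso_trans (lend_lmod_iso i) (alg_iso_sym (mx_lend_iso R m)).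
Qed.

End Corollary.

Theorem corollary5 (R : comPzRingType) :
  (monoid_iso (@Brstar_to_Br R) <->
     (forall P : lmodType R, ffgp P -> stably_matrix (lend P))) /\
  ((forall P : lmodType R, ffgp P -> free_module P) ->
     forall P : lmodType R, ffgp P -> stably_matrix (lend P)) /\
  ((forall P : lmodType R, ffgp P -> stably_tensor_free P) ->
     forall P : lmodType R, ffgp P -> stably_matrix (lend P)).
Proof.
split; first split.
- exact: Brstar_to_Br_iso_stably_matrix.
- exact: stably_matrix_Brstar_to_Br_iso.
split=> H P Pf; apply: stably_tensor_free_matrix => //; last exact: H.
exact: free_stably_tensor_free Pf (H P Pf).
Qed.
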